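(* Let $m\geq5$, $\ell\geq1$, $h=m-3$, and $k=\ell(m-2)+s$, where $s$ is an integer with $1\leq s<(m-2)/2$. Then $$M(k,m,h)=\ell m+s$$ and $$L(k,m,h)=\begin{cases}\ell m+s,&\text{if } m\text{ is odd and }s=(m-3)/2,\\ \ell m+s-1,&\text{otherwise}.\end{cases}$$ Thus, except when $m$ is odd and $s=(m-3)/2$, the general lower bound $L(k,m,h)$ for the rank of maximally $(m-3)$-scattered systems in $\mathbb{F}_{q^m}^k$ lies exactly one below the extremal rank $M(k,m,h)$.
   Context: For integers $h\geq1$, $m\geq h+1$, $k\geq h+1$, put $$M(k,m,h):=\left\lfloor\frac{km}{h+1}\right\rfloor,\qquad L(k,m,h):=\left\lceil\frac{m(k-h)}{h+1}\right\rceil+h.$$ Here $q$ is a prime power and $F=\mathbb{F}_{q^m}$. An $\mathbb{F}_q$-subspace $U\le F^k$ spanning $F^k$ over $F$ is an $h$-scattered system if $\dim_{\mathbb{F}_q}(U\cap H)\leq h$ for every $h$-dimensional $F$-subspace $H$ of $F^k$; its rank is $\dim_{\mathbb{F}_q}U$; it is maximally $h$-scattered if it is inclusion-maximal among $h$-scattered $\mathbb{F}_q$-subspaces of $F^k$. It is known that $h$-scattered systems have rank at most $M(k,m,h)$ (the extremal rank) and maximally $h$-scattered systems have rank at least $L(k,m,h)$. *)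

(* Defs.v *)
From HB Require Import structures.
From mathcomp Require Import all_boot all_order all_algebra.
Set Implicit Arguments.
Unset Strict Implicit.
Unset Printing Implicit Defensive.
Import Order.TTheory GRing.Theory Num.Theory.
Local Open Scope ring_scope.

(* The parameters are integers and the quotients are taken in rat, so that
   there is neither truncated subtraction nor rounded division; the formulas
   are meant for 1 <= h, h + 1 <= m and h + 1 <= k. *)
Definition extremal_rank (k m h : int) : int :=
  Num.floor ((k * m)%:Q / (h + 1)%:Q).

Definition maximal_rank_lower_bound (k m h : int) : int :=
  Num.ceil ((m * (k - h))%:Q / (h + 1)%:Q) + h.

(* Main.v *)
Require Import Defs.
From mathcomp Require Import all_boot all_order all_algebra.
From mathcomp Require Import ring zify.
Import Order.TTheory GRing.Theory Num.Theory.
Local Open Scope ring_scope.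

(** Put n = h + 1 = m - 2, so that k = l n + s and m = n + 2. Splitting off the
    integral parts gives
      k m / n = (l m + s) + 2 s / n,
      m (k - h) / n + h = (l m + s - 2) + 2 (s + 1) / n.
    The hypothesis on s says 0 < 2 s < n, so the floor of the first quantity is
    l m + s. It also gives 0 < 2 (s + 1) <= n + 1 < 2 n, so the fraction
    2 (s + 1) / n rounds up to 1, except when 2 (s + 1) = n + 1, where it
    rounds up to 2. That equality is s = (m - 3) / 2, and it forces m to be
    odd: this is the exceptional case. *)

Lemma floor_intdivE (a n c : int) :
  0 < n -> c * n <= a < (c + 1) * n -> Num.floor (a%:Q / n%:Q) = c.
Proof.
move=> n_gt0 /andP[lo hi]; have nQ_gt0 : 0 < n%:Q by rewrite ltr0z.
apply: floor_def.
by rewrite ler_pdivlMr // ltr_pdivrMr // -!intrM ler_int ltr_int lo.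
Qed.

Lemma ceil_intdivE (a n c : int) :
  0 < n -> (c - 1) * n < a <= c * n -> Num.ceil (a%:Q / n%:Q) = c.
Proof.
move=> n_gt0 /andP[lo hi]; have nQ_gt0 : 0 < n%:Q by rewrite ltr0z.
apply: ceil_def.
by rewrite ltr_pdivlMr // ler_pdivrMr // -!intrM ltr_int ler_int lo.
Qed.

Lemma ltr_int_half (a b : int) : (a%:Q < b%:Q / 2) = (a * 2 < b).
Proof. by rewrite ltr_pdivlMr // -[2]/(2%:~R) -intrM ltr_int. Qed.

Lemma eqr_int_half (a b : int) : (a%:Q == b%:Q / 2) = (a * 2 == b).
Proof.
by rewrite -(inj_eq (mulIf (_ : 2%:Q != 0))) // divfK // -intrM eqr_int.
Qed.

Theorem corollary2p3 (m l h k s : int)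
  (hm : 5 <= m) (hl : 1 <= l) (hh : h = m - 3)
  (hk : k = l * (m - 2) + s)
  (hs1 : 1 <= s) (hs2 : s%:Q < (m - 2)%:Q / 2) :
  let exceptional := ~~ (2 %| m)%Z && (s%:Q == (m - 3)%:Q / 2) in
  [/\ extremal_rank k m h = l * m + s,
      maximal_rank_lower_bound k m h =
        (if exceptional then l * m + s else l * m + s - 1)
    & ~~ exceptional ->
        maximal_rank_lower_bound k m h = extremal_rank k m h - 1].
Proof.
move=> exceptional.
rewrite ltr_int_half in hs2.
have h1E : h + 1 = m - 2 by rewrite hh; ring.
have n_gt0 : 0 < m - 2 by lia.
have exE : exceptional = (s * 2 == m - 3).
  rewrite /exceptional eqr_int_half; case: eqP => [sE|_]; last by rewrite andbF.
  by rewrite andbT; lia.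
have extremalE : extremal_rank k m h = l * m + s.
  rewrite /extremal_rank h1E; apply: floor_intdivE => //.
  have -> : k * m = (l * m + s) * (m - 2) + s * 2 by rewrite hk; ring.
  by rewrite (mulrDl (l * m + s)) mul1r lerDl ltrD2l hs2 andbT; lia.
have lowerE : maximal_rank_lower_bound k m h =
    (if exceptional then l * m + s else l * m + s - 1).
  rewrite /maximal_rank_lower_bound h1E.
  (* The integral part of m (k - h) / n. *)
  pose c := (l - 1) * m + s + 1.
  have numE : m * (k - h) = c * (m - 2) + (s + 1) * 2.
    by rewrite /c hk hh; ring.
  rewrite exE; case: eqP => sE.
    rewrite (@ceil_intdivE _ _ (c + 2)) // ?numE; first by rewrite /c hh; ring.
    have -> : c + 2 - 1 = c + 1 by ring.
    by rewrite !(mulrDl c) ltrD2l lerD2l; lia.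
  rewrite (@ceil_intdivE _ _ (c + 1)) // ?numE; first by rewrite /c hh; ring.
  by rewrite addrK (mulrDl c) ltrDl lerD2l; lia.
by split=> // /negbTE nex; rewrite lowerE extremalE nex.
Qed.
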